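(* Fix $d\ge 0$ and let $n\ge 2d^2+2d$. If $p\in\mathcal H(n,d)$, then $N(p)\ge (n-1)d+1$. Furthermore, if $N(p)=(n-1)d+1$, then $p\in\mathcal W$.
   Context: Write $s(x)=\sum_{j=1}^n x_j$. $\mathcal H(n,d)$ is the set of real polynomials in $x_1,\dots,x_n$ of total degree exactly $d$, with all coefficients nonnegative, such that $p(x)=1$ whenever $s(x)=1$. $N(p)$ denotes the number of distinct monomials occurring with nonzero coefficient in $p$. $\mathcal W$ is the set of polynomials obtainable from the constant polynomial $1$ by finitely many applications of operations of the form $g\mapsto g-u+s\,u$, where at each step $u$ is a polynomial such that both $u$ and $g-u$ have nonnegative coefficients. *)

(* Defs.v *)
From HB Require Import structures.
From mathcomp Require Import all_boot all_order all_algebra.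
From mathcomp Require Import reals.
From mathcomp Require Import mpoly.
Set Implicit Arguments. Unset Strict Implicit. Unset Printing Implicit Defensive.
Import Order.TTheory GRing.Theory Num.Theory.
Local Open Scope ring_scope.

Definition sumX (R : realType) (n : nat) : {mpoly R[n]} := \sum_(i < n) 'X_i.

Definition nonneg_coeffs (R : realType) (n : nat) (p : {mpoly R[n]}) : Prop :=
  forall m : 'X_{1..n}, 0 <= p@_m.

Definition inH (R : realType) (n d : nat) (p : {mpoly R[n]}) : Prop :=
  [/\ msize p = d.+1,
      nonneg_coeffs p &
      forall x : 'I_n -> R, \sum_(i < n) x i = 1 -> p.@[x] = 1].

Definition Nmon (R : realType) (n : nat) (p : {mpoly R[n]}) : nat :=
  size (msupp p).

Inductive inW (R : realType) (n : nat) : {mpoly R[n]} -> Prop :=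
  | inW_one : inW 1
  | inW_step (g u : {mpoly R[n]}) :
      inW g -> nonneg_coeffs u -> nonneg_coeffs (g - u) ->
      inW (g - u + sumX R n * u).

(* Main.v *)
Require Import Defs.
From HB Require Import structures.
From mathcomp Require Import all_boot all_order all_algebra.
From mathcomp Require Import zify ring lra.
From mathcomp Require Import reals.
From mathcomp Require Import mpoly.
Set Implicit Arguments. Unset Strict Implicit. Unset Printing Implicit Defensive.
Import Order.TTheory GRing.Theory Num.Theory.
Local Open Scope ring_scope.

(** On [s = 1] the polynomial p is constant, so [p = 1 + (s - 1) Q], and the degree [d]
    part of p is [s q] with [q] the degree [d - 1] part of Q.

    If [q >= 0], then [g := p - s q + q] lies in H(n, d - 1), p is obtained from g by one
    step of W, and [s q] has at least [n - 1] more monomials than [q]: induct on [d].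

    If [q] has a negative coefficient at m, let K be the set of the at least [n - d + 1]
    variables absent from m. For each 3-subset B of K some monomial of [s q] has at least
    two variables in B and no other variable in K: otherwise, the product of [x + y + z]
    by a form in three variables being a combination of pure powers only for the zero
    form, [q] has no monomial whose K-part is nontrivial and supported in B, and
    multiplying m by a variable of B exhibits a negative coefficient of [s q >= 0]. A
    monomial serves at most [|K| - 2] triples, so [s q] has at least [|K| (|K| - 1) / 6]
    monomials, more than [(n - 1) d + 1] as soon as [d >= 3]. *)

(** * Polynomials that vanish at every point *)

(** Reduction modulo [D] isolates the lowest digit. This makes the Kronecker substitution below
    injective on exponents. *)
Lemma digits_inj (D n : nat) (a b : 'I_n -> nat) :
  (forall i, a i < D)%N -> (forall i, b i < D)%N ->
  (\sum_(i < n) a i * D ^ i = \sum_(i < n) b i * D ^ i)%N -> a =1 b.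
Proof.
elim: n a b => [|n IHn] a b aD bD; first by move=> _ [].
have split_low (c : 'I_n.+1 -> nat) :
  (\sum_(i < n.+1) c i * D ^ i =
   c ord0 + (\sum_(i < n) c (lift ord0 i) * D ^ i) * D)%N.
  rewrite big_ord_recl expn0 muln1; congr (_ + _)%N.
  by rewrite big_distrl /=; apply: eq_bigr => i _; rewrite expnSr mulnA.
rewrite !split_low => eq_ab.
have D_gt0 : (0 < D)%N by apply: leq_ltn_trans (aD ord0).
have eq0 : a ord0 = b ord0.
  have /(congr1 (modn^~ D)) := eq_ab.
  by rewrite !(addnC (_ ord0)) !modnMDl !modn_small.
have /IHn eq_lift : (\sum_(i < n) a (lift ord0 i) * D ^ i =
                     \sum_(i < n) b (lift ord0 i) * D ^ i)%N.
  by apply/eqP; rewrite -(eqn_pmul2r D_gt0) -(eqn_add2l (a ord0)) eq_ab eq0.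
move=> i; case: (unliftP ord0 i) => [j|] -> //.
by apply: eq_lift.
Qed.

(** In characteristic 0 the numbers 0, ..., [size P - 1] are distinct: too many roots for a nonzero
    [P]. *)
Lemma poly_eval0 (R : numDomainType) (P : {poly R}) :
  (forall t, P.[t] = 0) -> P = 0.
Proof.
move=> P0; apply: contraTeq isT => nzP.
pose rs := [seq k%:R : R | k <- iota 0 (size P)].
have rsP : all (root P) rs by apply/allP => x _; rewrite rootE P0.
have rs_uniq : uniq rs.
  by rewrite map_inj_uniq ?iota_uniq // => i j /eqP; rewrite eqr_nat => /eqP.
by have := max_poly_roots nzP rsP rs_uniq; rewrite size_map size_iota ltnn.
Qed.

(* Kronecker substitution [x_i := t ^ (D ^ i)], with D exceeding every exponent of p. *)
Lemma mpoly_meval0 (R : realType) (n : nat) (p : {mpoly R[n]}) :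
  (forall x : 'I_n -> R, p.@[x] = 0) -> p = 0.
Proof.
move=> p0; pose D := msize p; pose e (m : 'X_{1..n}) := (\sum_(i < n) m i * D ^ i)%N.
have lt_mD m i : m \in msupp p -> (m i < D)%N.
  move=> /msize_mdeg_lt; apply: leq_ltn_trans.
  by rewrite mdegE (bigD1 i) //= leq_addr.
pose P : {poly R} := \sum_(m <- msupp p) p@_m *: 'X^(e m).
have P0 : P = 0.
  apply: poly_eval0 => t; rewrite -(p0 (fun i => t ^+ (D ^ i))) mevalE horner_sum.
  apply: eq_bigr => m _; rewrite hornerZ hornerXn; congr (_ * _).
  rewrite /e -prodrXr; apply: eq_bigr => i _.
  by rewrite -exprM mulnC.
apply: msuppnil0; case supp_p: (msupp p) => [//|m0 s].
have m0p : m0 \in msupp p by rewrite supp_p mem_head.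
(* Since [e] is injective on the support, only [m0] contributes to this coefficient of [P]. *)
have /eqP : P`_(e m0) = 0 by rewrite P0 coef0.
rewrite coef_sum (bigD1_seq m0) ?msupp_uniq //= coefZ coefXn eqxx mulr1.
rewrite big1_seq ?addr0; first by rewrite mcoeff_eq0 m0p.
move=> m /andP[ne_m mp]; rewrite coefZ coefXn; case: eqP => [e_eq|_]; last exact: mulr0.
case/negP: ne_m; apply/eqP/mnmP.
by apply: digits_inj (esym e_eq) => i; apply: lt_mD.
Qed.

(** * Divisibility by [s - 1] *)

(** Modulo [r] the substitution fixes each variable, and congruences are stable under sums and
    products. *)
Lemma comp_mpoly_sub_dvd (R : realType) (n : nat) (r : {mpoly R[n]})
    (lq : n.-tuple {mpoly R[n]}) (p : {mpoly R[n]}) :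
  (forall i, exists q, tnth lq i - 'X_i = r * q) ->
  exists q, (p \mPo lq) - p = r * q.
Proof.
move=> lqP; elim/mpolyind: p => [|c m p _ _ [q IHq]].
  by exists 0; rewrite comp_mpoly0 subrr mulr0.
suff [qm qmP] : exists q, ('X_[m] \mPo lq) - 'X_[m] = r * q.
  exists (c *: qm + q).
  rewrite comp_mpolyD comp_mpolyZ opprD addrACA IHq -scalerBr qmP.
  by rewrite mulrDr scalerAr.
rewrite comp_mpolyX mpolyXE_id.
apply: (big_ind2 (fun a b : {mpoly R[n]} => exists q, a - b = r * q)).
- by exists 0; rewrite subrr mulr0.
- move=> a a' b b' [q1 e1] [q2 e2]; exists (q1 * b + a' * q2).
  have -> : a * b - a' * b' = (a - a') * b + a' * (b - b') by ring.
  by rewrite e1 e2; ring.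
move=> i _; have [q0 e0] := lqP i.
elim: (m i) => [|k [q1 e1]]; first by exists 0; rewrite !expr0 subrr mulr0.
exists (q0 * tnth lq i ^+ k + 'X_i * q1).
have -> : tnth lq i ^+ k.+1 - 'X_i ^+ k.+1 =
  (tnth lq i - 'X_i) * tnth lq i ^+ k + 'X_i * (tnth lq i ^+ k - 'X_i ^+ k).
  by rewrite !exprS; ring.
by rewrite e0 e1; ring.
Qed.

Lemma meval_sumX (R : realType) (n : nat) (x : 'I_n -> R) :
  (sumX R n).@[x] = \sum_(i < n) x i.
Proof. by rewrite /sumX raddf_sum; apply: eq_bigr => i _; rewrite /= mevalXU. Qed.

(** Adding [1 - s] to one variable sends every point to the hyperplane [s = 1], so it turns [p] into
    the constant 1. The same substitution is the identity modulo [s - 1]. *)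
Lemma eval1_dvd (R : realType) (n : nat) (p : {mpoly R[n]}) : (0 < n)%N ->
  (forall x : 'I_n -> R, \sum_(i < n) x i = 1 -> p.@[x] = 1) ->
  exists Q, p = 1 + (sumX R n - 1) * Q.
Proof.
move=> n_gt0 p1; pose i0 := Ordinal n_gt0.
pose lq := [tuple ('X_i + if i == i0 then 1 - sumX R n else 0 : {mpoly R[n]}) | i < n].
have comp1 : p \mPo lq = 1.
  apply/eqP; rewrite -subr_eq0; apply/eqP/mpoly_meval0 => x.
  rewrite mevalB meval1 comp_mpoly_meval p1 ?subrr //.
  under eq_bigr => i _ do rewrite tnth_mktuple mevalD mevalXU.
  rewrite big_split /=.
  have -> : \sum_(i < n) (if i == i0 then 1 - sumX R n else 0).@[x] = 1 - \sum_(i < n) x i.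
    rewrite (bigD1 i0) //= ?eqxx /= mevalB meval1 meval_sumX [X in _ + X = _]big1 ?addr0 //.
    by move=> i /negPf->; exact: meval0.
  by rewrite addrC subrK.
have [|Q eQ] := @comp_mpoly_sub_dvd R n (sumX R n - 1) lq p.
  move=> i; rewrite tnth_mktuple addrC addKr; case: eqP => _.
    by exists (-1); ring.
  by exists 0; rewrite mulr0.
by exists (- Q); rewrite mulrN -eQ comp1; ring.
Qed.

(** * Coefficients of [s q] and the top-degree part of [p] *)

Lemma mcoeff_sumXM (R : realType) (n : nat) (q : {mpoly R[n]}) (m : 'X_{1..n}) :
  (sumX R n * q)@_m = \sum_(i < n | (0 < m i)%N) q@_(m - U_(i)).
Proof.
rewrite /sumX mulr_suml raddf_sum [RHS]big_mkcond; apply: eq_bigr => i _ /=.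
rewrite mulrC; case: ifP => [mi|mi].
  have Uim : (U_(i) <= m)%MM by rewrite lep1mP -lt0n.
  by rewrite -{1}(submK Uim) addmC mcoeffMX.
apply/memN_msupp_eq0/negP; rewrite (perm_mem (msuppMX _ _)) => /mapP[m' _ em].
by move: mi; rewrite em mnmDE mnm1E eqxx.
Qed.

Lemma sumX_coeffU (R : realType) (n : nat) (i : 'I_n) : (sumX R n)@_U_(i) = 1.
Proof.
rewrite /sumX raddf_sum (bigD1 i) //= mcoeffXU eqxx big1 ?addr0 // => j /negPf ji.
by rewrite mcoeffXU ji.
Qed.

Lemma mcoeff_pihomog (R : realType) (n d : nat) (p : {mpoly R[n]}) (m : 'X_{1..n}) :
  (pihomog mdeg d p)@_m = if mdeg m == d then p@_m else 0.
Proof.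
rewrite pihomogE raddf_sum /=.
under eq_bigr => k _ do rewrite mcoeffZ mcoeffX.
have [mp|mp] := boolP (m \in msupp p); last first.
  rewrite (memN_msupp_eq0 mp) if_same big1_seq // => k /andP[_ kp].
  by case: eqP => [ekm|_]; rewrite ?mulr0 // -ekm kp in mp *.
rewrite big_mkcond /= (bigD1_seq m) ?msupp_uniq //= eqxx mulr1 big1 ?addr0 //.
by move=> k /negPf->; rewrite mulr0 if_same.
Qed.

Lemma inH_top_factor (R : realType) (n d : nat) (p : {mpoly R[n]}) :
  (0 < n)%N -> inH d.+1 p ->
  exists2 q : {mpoly R[n]}, q \is d.-homog &
    forall m, mdeg m = d.+1 -> p@_m = (sumX R n * q)@_m.
Proof.
move=> n_gt0 [szp _ /(eval1_dvd n_gt0)[Q eQ]].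
have nz_s1 : (sumX R n - 1)@_U_(Ordinal n_gt0) = 1.
  by rewrite mcoeffB sumX_coeffU mcoeff1 mnm1_eq0 subr0.
have sz_s1 : (1 < msize (sumX R n - 1))%N.
  rewrite -(mdeg1 (Ordinal n_gt0)) msize_mdeg_lt // mcoeff_msupp nz_s1.
  exact: oner_neq0.
(* [msize] is the degree plus one, and [s - 1] has degree at least 1, so [Q] has degree at most
   [d]. *)
have szQ : (msize Q <= d.+1)%N.
  have [->|nzQ] := eqVneq Q 0; first by rewrite mmeasure0.
  have := msizeD_le p (- 1); rewrite [in msize (p - 1)]eQ addrC addKr msizeN msize1 szp.
  rewrite msizeM //.
    by move: (mmeasure _ _) (mmeasure _ _) sz_s1 => a b; lia.
  by apply: contraTneq sz_s1 => ->; rewrite mmeasure0.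
exists (pihomog mdeg d Q); first exact: pihomogP.
move=> m dm; rewrite [in LHS]eQ mulrBl mul1r mcoeffD mcoeffB mcoeff1.
have -> : (m == 0%MM) = false by rewrite -mdeg_eq0 dm.
(* In degree [d.+1] neither 1 nor [Q] contributes to [1 + s Q - Q], and [s Q] only involves
   coefficients of [Q] in degree [d]. *)
rewrite add0r (memN_msupp_eq0 (p := Q)); last by apply: msize_mdeg_ge; rewrite dm.
rewrite subr0 !mcoeff_sumXM; apply: eq_bigr => i mi.
have Uim : (U_(i) <= m)%MM by rewrite lep1mP -lt0n.
rewrite mcoeff_pihomog; case: eqP => // [[]].
by apply: succn_inj; rewrite -dm -{2}(submK Uim) mdegD mdeg1 addn1.
Qed.

(** * Counting the monomials of [s q] for nonnegative [q] *)

Lemma msupp_sumXM (R : realType) (n : nat) (q : {mpoly R[n]}) m i :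
  nonneg_coeffs q -> m \in msupp q -> (m + U_(i))%MM \in msupp (sumX R n * q).
Proof.
move=> q_ge0; rewrite !mcoeff_msupp mcoeff_sumXM => qm_neq0.
have mUi : (0 < (m + U_(i))%MM i)%N by rewrite mnmDE mnm1E eqxx addn1.
rewrite (bigD1 i) //= addmK gt_eqF // ltr_wpDr ?sumr_ge0 //.
by rewrite lt_def qm_neq0 q_ge0.
Qed.

(** Take [m0] in the support with the least exponent at [i0]. The products of all monomials by
    variable [i0], and of [m0] by the other variables, are distinct: the latter have a smaller
    exponent at [i0]. Nonnegativity excludes cancellation. *)
Lemma Nmon_sumXM (R : realType) (n : nat) (q : {mpoly R[n]}) :
  (0 < n)%N -> nonneg_coeffs q -> q != 0 ->
  (Nmon q + (n - 1) <= Nmon (sumX R n * q))%N.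
Proof.
move=> n_gt0 q_ge0 nzq; pose i0 := Ordinal n_gt0; rewrite /Nmon.
have [m0 m0q m0_min] : exists2 m0, m0 \in msupp q &
    forall m, m \in msupp q -> (m0 i0 <= m i0)%N.
  have exk : exists k, has (fun m : 'X_{1..n} => m i0 == k) (msupp q).
    by exists (mlead q i0); apply/hasP; exists (mlead q); rewrite ?mlead_supp.
  case: (ex_minnP exk) => k /hasP[m0 m0q /eqP m0k] k_min; exists m0 => // m mq.
  by rewrite m0k; apply: k_min; apply/hasP; exists m.
pose L := [seq (m + U_(i0))%MM | m <- msupp q] ++
          [seq (m0 + U_(i))%MM | i <- enum (predC1 i0)].
have szL : size L = (size (msupp q) + (n - 1))%N.
  rewrite size_cat !size_map -cardE; congr (_ + _)%N.
  by have := cardC1 i0; rewrite card_ord subn1.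
rewrite -szL; apply: uniq_leq_size.
  rewrite cat_uniq map_inj_uniq ?msupp_uniq /=; last exact: addIm.
  rewrite [X in _ && X]map_inj_uniq ?enum_uniq ?andbT; last first.
    by move=> i j /addmI/eqP; rewrite eq_mnm1 => /eqP.
  apply/hasPn => x /mapP[i + ->]; rewrite mem_enum => /negPf ii0.
  apply/mapP => -[m /m0_min m0m /mnmP/(_ i0)].
  by move: ii0; rewrite !mnmDE !mnm1E eqxx => ->; lia.
by move=> m; rewrite mem_cat => /orP[] /mapP[? ? ->]; apply: msupp_sumXM.
Qed.

Lemma homog_sumXM (R : realType) (n d : nat) (q : {mpoly R[n]}) :
  q \is d.-homog -> sumX R n * q \is d.+1.-homog.
Proof.
move=> q_hom; rewrite -add1n; apply: dhomogM => //.
by rewrite /sumX; apply: rpred_sum => i _; rewrite dhomogX; apply/eqP; exact: mdeg1.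
Qed.

Lemma dhomog_coeff_eq0 (R : realType) (n d : nat) (q : {mpoly R[n]}) m :
  q \is d.-homog -> mdeg m != d -> q@_m = 0.
Proof.
move=> /dhomogP q_hom; apply: contraNeq => nz.
by rewrite q_hom // mcoeff_msupp.
Qed.

(** * Lowering the degree by one step *)

Section Descent.

Variables (R : realType) (n d : nat) (p q : {mpoly R[n]}).
Hypotheses (n_gt0 : (0 < n)%N) (pH : inH d.+1 p) (q_hom : q \is d.-homog).
Hypothesis p_top : forall m, mdeg m = d.+1 -> p@_m = (sumX R n * q)@_m.

Let s := sumX R n.

Lemma mcoeff_top_supp m : (s * q)@_m != 0 -> p@_m = (s * q)@_m.
Proof.
move=> nz; apply: p_top; apply/eqP; apply: contraNT nz => dm.
by rewrite (dhomog_coeff_eq0 (homog_sumXM q_hom)).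
Qed.

Lemma mcoeff_low m : (p - s * q)@_m = if (mdeg m < d.+1)%N then p@_m else 0.
Proof.
have [szp _ _] := pH; rewrite mcoeffB.
have [md|md|md] := ltngtP (mdeg m) d.+1.
- by rewrite (dhomog_coeff_eq0 (homog_sumXM q_hom)) ?subr0 // ltn_eqF.
- rewrite (dhomog_coeff_eq0 (homog_sumXM q_hom)) ?gtn_eqF // subr0.
  by apply/memN_msupp_eq0/msize_mdeg_ge; rewrite szp.
by rewrite p_top ?subrr.
Qed.

Lemma nonneg_low : nonneg_coeffs (p - s * q).
Proof.
by have [_ p_ge0 _] := pH; move=> m; rewrite mcoeff_low; case: ifP.
Qed.

Lemma top_factor_neq0 : q != 0.
Proof.
have [szp _ _] := pH.
have nzp : p != 0 by rewrite -msize_poly_eq0 szp.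
have dl : mdeg (mlead p) = d.+1 by apply: succn_inj; rewrite mlead_deg.
have := mlead_supp nzp; rewrite mcoeff_msupp p_top //.
by apply: contraNneq => ->; rewrite mulr0 mcoeff0.
Qed.

(** Where [s = 1], replacing [s * q] by [q] changes no value. The degree is exactly [d] because the
    nonnegative [p - s * q] cannot cancel the leading coefficient of [q]. *)
Lemma inH_descent : nonneg_coeffs q -> inH d (p - s * q + q).
Proof.
move=> q_ge0; have [szp p_ge0 p1] := pH; have low_ge0 := nonneg_low.
split; last 2 first.
- by move=> m; rewrite mcoeffD addr_ge0.
- move=> x sx1; rewrite mevalD mevalB mevalM meval_sumX sx1 mul1r subrK.
  exact: p1.
apply/eqP; rewrite eqn_leq; apply/andP; split.
  rewrite [X in (X <= _)%N]msizeE; apply/bigmax_leqP_seq => m.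
  rewrite mcoeff_msupp => + _; rewrite ltnS; apply: contraNT; rewrite -ltnNge => dm.
  by rewrite mcoeffD mcoeff_low ltnNge dm (dhomog_coeff_eq0 q_hom) ?gtn_eqF ?addr0.
have /mlead_supp q_lead := top_factor_neq0.
rewrite -(dhomog_mf q_hom q_lead); apply: msize_mdeg_lt.
move: q_lead; rewrite !mcoeff_msupp => q_lead.
by rewrite mcoeffD gt_eqF // ltr_wpDl ?low_ge0 // lt_def q_lead q_ge0.
Qed.

Lemma Nmon_split : Nmon p = (Nmon (p - s * q) + Nmon (s * q))%N.
Proof.
rewrite /Nmon -size_cat -{1}(subrK (s * q) p).
apply/perm_size/msuppD => m /=; rewrite !mcoeff_msupp mcoeff_low.
apply/negbTE; rewrite negb_and !negbK.
case: ltnP => [md|]; last by rewrite eqxx.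
by rewrite (dhomog_coeff_eq0 (homog_sumXM q_hom)) ?eqxx ?orbT // ltn_eqF.
Qed.

Lemma Nmon_top : (Nmon (s * q) <= Nmon p)%N.
Proof. by rewrite Nmon_split leq_addl. Qed.

(** Replacing [s * q] by [q] saves [n - 1] monomials, and overlaps of [q] with the lower part only
    save more. *)
Lemma Nmon_descent : nonneg_coeffs q ->
  (Nmon (p - s * q + q) + (n - 1) <= Nmon p)%N.
Proof.
move=> q_ge0; have := Nmon_sumXM n_gt0 q_ge0 top_factor_neq0.
rewrite Nmon_split -/s => leNq.
have : (Nmon (p - s * q + q) <= Nmon (p - s * q) + Nmon q)%N.
  by rewrite /Nmon -size_cat; apply: uniq_leq_size; [exact: msupp_uniq|exact: msuppD_le].
lia.
Qed.

End Descent.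

(** * Negative coefficients and triples of variables *)

(* With [F] the generating polynomial of [f], the hypothesis says that [(x + y + z) F]
   is a combination of [x ^ e.+2], [y ^ e.+2] and [z ^ e.+2]; the conclusion is [F = 0]. *)
Lemma triple_recurrence (R : realFieldType) (f : nat -> nat -> nat -> R) (e : nat) :
  (forall a b c, (a + b + c = e.+2)%N -> (1 < (0 < a) + (0 < b) + (0 < c))%N ->
     (if (0 < a)%N then f a.-1 b c else 0) + (if (0 < b)%N then f a b.-1 c else 0) +
     (if (0 < c)%N then f a b c.-1 else 0) = 0) ->
  forall a b c, (a + b + c = e.+1)%N -> f a b c = 0.
Proof.
move=> fH; pose t := f 0%N e.+1 0%N.
have edge a b : (a + b = e.+1)%N -> f a b 0%N = (-1) ^+ a * t.
  elim: a b => [|a IHa] b; first by rewrite add0n => ->; rewrite mul1r.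
  move=> eab; have := fH a.+1 b.+1 0%N ltac:(lia) ltac:(lia); rewrite /= IHa; last lia.
  by rewrite exprS; move: (_ ^+ a) => u; lra.
(* The rows [c = 0] and [c = 1] are determined by [t], starting from [a = 0]. *)
have layer1 a b : (a + b = e)%N -> f a b 1%N = - ((-1) ^+ a * t * a.+1%:R).
  elim: a b => [|a IHa] b.
    rewrite add0n => ->; have := fH 0%N e.+1 1%N ltac:(lia) ltac:(lia).
    by rewrite /= edge // !expr0; lra.
  move=> eab; have := fH a.+1 b.+1 1%N ltac:(lia) ltac:(lia); rewrite /= IHa ?edge; try lia.
  rewrite exprS -[a.+2%:R]natr1; move: (_ ^+ a) (a.+1%:R) => u v.
  by lra.
(* At the opposite end [a = e.+1] the two rows meet again, giving [(e + 2) t = 0] up to sign. *)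
have t0 : t = 0.
  have := fH e.+1 0%N 1%N ltac:(lia) ltac:(lia); rewrite /= layer1 ?edge; try lia.
  have : (-1) ^+ e != 0 :> R by rewrite signr_eq0.
  rewrite exprS -[e.+1%:R]natr1; have := ler0n R e.
  move: (_ ^+ e) (e%:R) => u v v_ge0 u_neq0 eq0.
  have /eqP : u * (t * (v + 2)) = 0 by lra.
  by rewrite !mulf_eq0 (negPf u_neq0) => /= /orP[/eqP|/eqP]; lra.
move=> a b c; elim: c a b => [|c IHc] a b.
  by rewrite addn0 => /edge ->; rewrite t0 mulr0.
elim: a b => [|a IHa] b eabc.
  have := fH 0%N b.+1 c.+1 ltac:(lia) ltac:(lia).
  by rewrite /= add0r IHc ?addr0 //; lia.
have := fH a.+1 b.+1 c.+1 ltac:(lia) ltac:(lia).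
by rewrite /= IHa ?IHc ?addr0 ?add0r //; lia.
Qed.

(** Double counting: a set [S] containing distinct [x] and [y] lies in at most [#|K| - 2] triples of
    [K], each determined by its third element. *)
Lemma triple_count (T : finType) (K : {set T}) (F : seq {set T}) :
  (forall B : {set T}, B \subset K -> #|B| = 3 ->
     exists2 S, S \in F & (S \subset B) && (1 < #|S|)%N) ->
  ('C(#|K|, 3) <= size F * (#|K| - 2))%N.
Proof.
move=> wit.
pose above (S : {set T}) := [set B : {set T} | (B \subset K) && (#|B| == 3) &
                                               (S \subset B) && (1 < #|S|)%N].
have above_le S : (#|above S| <= #|K| - 2)%N.
  have [->|[B0]] := set_0Vmem (above S); first by rewrite cards0.
  rewrite inE => /andP[/andP[B0K _] /andP[SB0 /card_gt1P[x [y [xS yS xy]]]]].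
  have xK : x \in K by rewrite (subsetP B0K) // (subsetP SB0).
  have yK : y \in K by rewrite (subsetP B0K) // (subsetP SB0).
  have cardK : #|K :\ x :\ y| = (#|K| - 2)%N.
    by rewrite (cardsD1 x K) xK (cardsD1 y (K :\ x)) !inE eq_sym xy yK; lia.
  rewrite -cardK; apply: leq_trans (leq_imset_card (fun z => [set x; y; z]) _).
  apply/subset_leq_card/subsetP => B; rewrite inE => /andP[/andP[BK /eqP B3] /andP[SB _]].
  have xB := subsetP SB x xS; have yB := subsetP SB y yS.
  have yBx : y \in B :\ x by rewrite !inE eq_sym xy.
  have /cards1P[z Bz] : #|B :\ x :\ y| == 1.
    by apply/eqP; move: B3; rewrite (cardsD1 x B) xB (cardsD1 y (B :\ x)) yBx; lia.
  apply/imsetP; exists z.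
    have : z \in B :\ x :\ y by rewrite Bz set11.
    by apply: subsetP; do 2 apply: setSD.
  by rewrite -(setD1K xB) -(setD1K yBx) Bz setUA.
rewrite -cards_draws.
apply: (@leq_trans #|\bigcup_(S <- F) above S|).
  apply/subset_leq_card/subsetP => B; rewrite inE => /andP[BK /eqP B3].
  have [S SF /andP[SB S_gt1]] := wit B BK B3.
  by rewrite (big_rem S) //= !inE BK B3 SB S_gt1.
elim: (F) => [|S F' IHF]; first by rewrite big_nil cards0.
rewrite big_cons mulSn; apply: leq_trans (leq_card_setU _ _) _.
by apply: leq_add.
Qed.

(** Freezing the other exponents of [r] makes the coefficients of [q] a function of three indices,
    as [triple_recurrence] requires. *)
Definition triple_upd (n : nat) (x y z : 'I_n) (r : 'X_{1..n}) (a b c : nat) : 'X_{1..n} :=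
  [multinom if i == x then a else if i == y then b else if i == z then c else r i | i < n].

Section Triple.

Variables (R : realType) (n d : nat) (q : {mpoly R[n]}) (K : {set 'I_n}) (x y z : 'I_n).
Hypotheses (q_hom : q \is d.-homog) (xy : x != y) (xz : x != z) (yz : y != z).

Let in_triple (m : 'X_{1..n}) := forall i, i \in K -> (0 < m i)%N -> i \in [set x; y; z].

Hypothesis sq0 : forall m, in_triple m ->
  (1 < (0 < m x) + (0 < m y) + (0 < m z))%N -> (sumX R n * q)@_m = 0.

(** Descending induction on the degree in [x], [y], [z], which homogeneity bounds by [d]. In the
    coefficient of [s q], dividing by a variable outside the triple leaves a larger triple degree
    than that of [r], so those terms vanish and [triple_recurrence] applies. *)
Lemma triple_vanish r : in_triple r -> (0 < r x + r y + r z)%N -> q@_r = 0.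
Proof.
have [k] := ubnP (d.+1 - (r x + r y + r z)); elim: k r => // k IHk r le_k r_in.
case r_deg: (r x + r y + r z)%N => [//|e] _.
have [le_d|gt_d] := leqP (r x + r y + r z) d; last first.
  rewrite (dhomog_coeff_eq0 q_hom) // gtn_eqF //; apply: leq_trans gt_d _.
  rewrite mdegE (bigD1 x) //= (bigD1 y) 1?eq_sym //=.
  rewrite (bigD1 z) /=; last by rewrite ![z == _]eq_sym xz.
  by lia.
pose f a b c := q@_(triple_upd x y z r a b c).
have updE a b c : (triple_upd x y z r a b c x = a) * (triple_upd x y z r a b c y = b) *
                  (triple_upd x y z r a b c z = c).
  by rewrite !mnmE !eqxx ![_ == x]eq_sym (eq_sym z y) (negPf xy) (negPf xz) (negPf yz).
have updBx a b c : (triple_upd x y z r a b c - U_(x))%MM = triple_upd x y z r a.-1 b c.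
  apply/mnmP => i; rewrite mnmBE !mnmE (eq_sym x).
  by case: eqVneq => _; rewrite ?subn1 ?subn0.
have updBy a b c : (triple_upd x y z r a b c - U_(y))%MM = triple_upd x y z r a b.-1 c.
  apply/mnmP => i; rewrite mnmBE !mnmE (eq_sym y).
  case: (eqVneq i x) => [->|_]; first by rewrite (negPf xy) subn0.
  by case: eqVneq => _; rewrite ?subn1 ?subn0.
have updBz a b c : (triple_upd x y z r a b c - U_(z))%MM = triple_upd x y z r a b c.-1.
  apply/mnmP => i; rewrite mnmBE !mnmE (eq_sym z).
  case: (eqVneq i x) => [->|_]; first by rewrite (negPf xz) subn0.
  case: (eqVneq i y) => [->|_]; first by rewrite (negPf yz) subn0.
  by case: eqVneq => _; rewrite ?subn1 ?subn0.
have upd_other i a b c : i \notin [set x; y; z] -> triple_upd x y z r a b c i = r i.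
  by rewrite !inE !negb_or mnmE -andbA => /and3P[/negPf-> /negPf-> /negPf->].
have upd_in a b c : in_triple (triple_upd x y z r a b c).
  move=> i iK; apply: contraTT => iT; rewrite upd_other //.
  by apply: contra iT; apply: r_in.
have -> : q@_r = f (r x) (r y) (r z).
  congr (q@_ _); apply/mnmP => i; rewrite mnmE.
  by case: eqP => [->//|_]; case: eqP => [->//|_]; case: eqP => [->|].
apply: triple_recurrence (r_deg) => a b c abc two.
have := sq0 (upd_in a b c); rewrite !updE => /(_ two).
rewrite mcoeff_sumXM big_mkcond (bigD1 x) //= (bigD1 y) 1?eq_sym //=.
rewrite (bigD1 z) /=; last by rewrite ![z == _]eq_sym xz.
rewrite big1 => [|i /andP[/andP[ix iy] iz]].
  by rewrite !updE addr0 !updBx !updBy !updBz addrA.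
have iT : i \notin [set x; y; z] by rewrite !inE !negb_or ix iy.
pose m := triple_upd x y z r a b c.
have mBE j : j \in [set x; y; z] -> (m - U_(i))%MM j = m j.
  move=> jT; rewrite mnmBE mnm1E; case: eqP => [eij|_]; last exact: subn0.
  by rewrite eij jT in iT.
case: ifP => // mi_gt0; apply: IHk.
- by rewrite !mBE ?inE ?eqxx ?orbT // !updE; lia.
- move=> j jK; rewrite mnmBE => mj; apply: (upd_in a b c) => //; lia.
by rewrite !mBE ?inE ?eqxx ?orbT // !updE; lia.
Qed.

(** Dividing [m + U_(x)] by a variable other than [x] leaves a monomial whose only variable in [K]
    is [x]; [triple_vanish] kills it. *)
Lemma mcoeff_shift_triple (m : 'X_{1..n}) : x \in K -> {in K, forall i, m i = 0%N} ->
  q@_m = (sumX R n * q)@_(m + U_(x)).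
Proof.
move=> xK mK; rewrite mcoeff_sumXM.
have mx : (0 < (m + U_(x))%MM x)%N by rewrite mnmDE mnm1E eqxx addn1.
rewrite (bigD1 x) //= addmK big1 ?addr0 // => i /andP[mi ix].
apply: triple_vanish => [j jK|].
  rewrite mnmBE mnmDE mK // mnm1E !inE; case: (eqVneq x j) => [//|_].
  by rewrite sub0n.
by rewrite mnmBE mnmDE !mnm1E eqxx (negPf ix); lia.
Qed.

End Triple.

(** A pure power has a single divisor of degree one less. Hence a negative coefficient of [q] at a
    pure power would survive in [s q]. *)
Lemma mcoeff_pure_power (R : realType) (n : nat) (q : {mpoly R[n]}) (m : 'X_{1..n}) i :
  (forall j, j != i -> m j = 0%N) -> (sumX R n * q)@_(m + U_(i)) = q@_m.
Proof.
move=> m_pure; rewrite mcoeff_sumXM.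
have mi : (0 < (m + U_(i))%MM i)%N by rewrite mnmDE mnm1E eqxx addn1.
rewrite (bigD1 i) //= addmK big1 ?addr0 // => j /andP[+ ji].
by rewrite mnmDE mnm1E m_pure // eq_sym (negPf ji).
Qed.

Lemma triple_supp_witness (R : realType) (n d : nat) (q : {mpoly R[n]}) (m : 'X_{1..n})
    (B : {set 'I_n}) :
  q \is d.-homog -> nonneg_coeffs (sumX R n * q) -> q@_m < 0 ->
  B \subset [set i | m i == 0%N] -> #|B| = 3 ->
  exists2 M, M \in msupp (sumX R n * q) &
    let S := [set i | (m i == 0%N) && (0 < M i)%N] in (S \subset B) && (1 < #|S|)%N.
Proof.
move=> q_hom sq_ge0 qm_lt0 BK B3; pose K := [set i | m i == 0%N].
have /card_gt2P[x [y [z [[xB yB zB] [xy yz zx]]]]] : (2 < #|B|)%N by rewrite B3.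
have defB : [set x; y; z] = B.
  apply/eqP; rewrite eqEcard; apply/andP; split.
    by apply/subsetP => i; rewrite !inE -orbA => /or3P[] /eqP->.
  by rewrite B3 -setUA cardsU1 cards2 !inE negb_or xy (eq_sym x) zx yz.
have [xK yK zK] : [/\ x \in K, y \in K & z \in K] by split; apply: (subsetP BK).
apply/hasP; apply: contraT => /hasPn none.
have xz : x != z by rewrite eq_sym.
have sq0 (M : 'X_{1..n}) : (forall i, i \in K -> (0 < M i)%N -> i \in [set x; y; z]) ->
    (1 < (0 < M x) + (0 < M y) + (0 < M z))%N -> (sumX R n * q)@_M = 0.
  move=> M_in two; apply: memN_msupp_eq0; apply: contraTN two => /none.
  rewrite negb_and => /orP[/negP|]; first case.
    apply/subsetP => i; rewrite inE -defB => /andP[mi Mi].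
    by apply: M_in => //; rewrite inE.
  apply: contra => two; apply/card_gt1P.
  move: xK yK zK two; rewrite !inE => xK yK zK.
  have [Mx|Mx] := boolP (0 < M x)%N; have [My|My] := boolP (0 < M y)%N => //=.
  - by move=> _; exists x, y; split; rewrite ?inE ?xK ?yK ?Mx ?My.
  - by case: (ltnP 0 (M z)) => // Mz _; exists x, z; split; rewrite ?inE ?xK ?zK ?Mx ?Mz.
  - by case: (ltnP 0 (M z)) => // Mz _; exists y, z; split; rewrite ?inE ?yK ?zK ?My ?Mz.
  by case: (ltnP 0 (M z)).
have mK : {in K, forall i, m i = 0%N} by move=> i; rewrite inE => /eqP.
have := sq_ge0 (m + U_(x))%MM.
by rewrite -(mcoeff_shift_triple q_hom xy xz yz sq0 xK mK) leNgt qm_lt0.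
Qed.

Lemma negative_coeff_count (R : realType) (n d : nat) (q : {mpoly R[n]}) (m : 'X_{1..n}) :
  q \is d.-homog -> nonneg_coeffs (sumX R n * q) -> q@_m < 0 ->
  exists2 k, (n - d <= k)%N & ('C(k, 3) <= Nmon (sumX R n * q) * (k - 2))%N.
Proof.
move=> q_hom sq_ge0 qm_lt0; pose K := [set i | m i == 0%N]; exists #|K|.
  have <- : mdeg m = d by apply: (dhomog_mf q_hom); rewrite mcoeff_msupp lt_eqF.
  suff : (#|~: K| <= mdeg m)%N by have := cardsC K; rewrite card_ord; lia.
  rewrite mdegE -sum1_card big_mkcond /=; apply: leq_sum => i _.
  by rewrite inE inE -lt0n; case: (m i).
(* Monomials with the same variables in [K] give the same set; the list keeps repetitions, so its
   size is the number of monomials. *)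
rewrite /Nmon -(size_map (fun M : 'X_{1..n} => [set i | (m i == 0%N) && (0 < M i)%N])).
apply: triple_count => B BK B3.
have [M MF SB] := triple_supp_witness q_hom sq_ge0 qm_lt0 BK B3.
by exists [set i | (m i == 0%N) && (0 < M i)%N] => //; apply: map_f.
Qed.

(** * Numerical comparison *)

Lemma bin3_bound (k N : nat) : (2 < k)%N -> ('C(k, 3) <= N * (k - 2))%N ->
  (k * (k - 1) <= 6 * N)%N.
Proof.
move=> k_gt2 le_bin.
have := bin_ffact k 3; rewrite !ffactnS ffactn0 muln1 (_ : 3`! = 6)%N // => e.
by nia.
Qed.

(** Here [d.+2] is the degree of [q] and [d.+3] that of [p]. As [k (k - 1)] is monotone, [k] may be
    replaced by its lower bound [l], which is quadratic in the degree. *)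
Lemma count_arith (n d k : nat) :
  (2 * d.+3 ^ 2 + 2 * d.+3 <= n)%N -> (n - d.+2 <= k)%N ->
  (6 * ((n - 1) * d.+3 + 1) < k * (k - 1))%N.
Proof.
move=> n_ge k_ge; pose l := (n - d.+2)%N.
have l_ge : (2 * d.+3 ^ 2 + d.+3 + 1 <= l)%N by rewrite /l; lia.
have -> : (n - 1 = l + d.+1)%N by rewrite /l; lia.
apply: (@leq_trans (l * (l - 1))); last by apply: leq_mul => //; apply: leq_sub2r.
move: l_ge; rewrite !expnS expn0 muln1; nia.
Qed.

(* Linear forms and constants are exceptional: their monomials are pure powers. *)
Lemma top_factor_nonneg_or_many (R : realType) (n d : nat) (q : {mpoly R[n]}) :
  (0 < n)%N -> (2 * d.+1 ^ 2 + 2 * d.+1 <= n)%N ->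
  q \is d.-homog -> nonneg_coeffs (sumX R n * q) ->
  nonneg_coeffs q \/ ((n - 1) * d.+1 + 1 < Nmon (sumX R n * q))%N.
Proof.
move=> n_gt0 n_ge q_hom sq_ge0.
have [/allP q_ge0|] := boolP (all (fun m => 0 <= q@_m) (msupp q)).
  left=> m; have [/q_ge0//|/memN_msupp_eq0->//] := boolP (m \in msupp q).
rewrite -has_predC => /hasP[m mq /=]; rewrite -ltNge => qm_lt0; right.
have dm := dhomog_mf q_hom mq.
have pure i : ~ (forall j, j != i -> m j = 0%N).
  move=> m_pure; have eq_m := mcoeff_pure_power q m_pure.
  by have := sq_ge0 (m + U_(i))%MM; rewrite eq_m leNgt qm_lt0.
case: d => [|[|d]] in n_ge q_hom dm *.
- case: (pure (Ordinal n_gt0)) => j _.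
  by move/eqP: dm; rewrite mdeg_eq0 => /eqP->; rewrite mnm0E.
- have /mdeg1P[i /eqP mi] : mdeg m == 1%N by rewrite dm.
  by case: (pure i) => j ji; rewrite mi mnm1E eq_sym (negPf ji).
have [k k_ge le_bin] := negative_coeff_count q_hom sq_ge0 qm_lt0.
have k_gt2 : (2 < k)%N by apply: leq_trans k_ge; nia.
have := bin3_bound k_gt2 le_bin; move: (Nmon _) => N le_N.
have : (6 * ((n - 1) * d.+3 + 1) < k * (k - 1))%N by apply: count_arith k_ge.
lia.
Qed.

(** * Induction on the degree *)

Theorem theorem2 (R : realType) (d n : nat) (p : {mpoly R[n]}) :
  (0 < n)%N -> (2 * d ^ 2 + 2 * d <= n)%N -> @inH R n d p ->
  ((n - 1) * d + 1 <= @Nmon R n p)%N /\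
  (@Nmon R n p = ((n - 1) * d + 1)%N -> @inW R n p).
Proof.
move=> n_gt0; elim: d p => [|d IHd] p n_ge pH.
  have [szp _ p1] := pH.
  have p_cst : p = (p@_0%MM)%:MP by apply: msize1_polyC; rewrite szp.
  have p_eq1 : p = 1.
    have := p1 (fun i => (i == Ordinal n_gt0)%:R); rewrite {1}p_cst mevalC => c1.
    rewrite p_cst c1 // (bigD1 (Ordinal n_gt0)) //= ?eqxx big1 ?addr0 //.
    by move=> i /negPf->.
  by rewrite p_eq1 /Nmon msupp1 muln0; split=> // _; apply: inW_one.
have [q q_hom p_top] := inH_top_factor n_gt0 pH.
have sq_ge0 : nonneg_coeffs (sumX R n * q).
  have [_ p_ge0 _] := pH => m.
  by have [->//|/(mcoeff_top_supp q_hom p_top)<-//] := eqVneq ((sumX R n * q)@_m) 0.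
have [q_ge0|lt_N] := top_factor_nonneg_or_many n_gt0 n_ge q_hom sq_ge0; last first.
  by have := Nmon_top pH q_hom p_top; lia.
have gH := inH_descent pH q_hom p_top q_ge0.
have g_N := Nmon_descent n_gt0 pH q_hom p_top q_ge0.
have [|leN eqW] := IHd _ _ gH; first by nia.
rewrite mulnS; split; first lia.
(* Equality for [p] leaves [g] at most [(n - 1) * d + 1] monomials, hence equality for [g], which is
   then in W; [u := q] is the last step. *)
move=> eN; set g := p - sumX R n * q + q in gH g_N leN eqW.
have eg : g - q = p - sumX R n * q by rewrite /g addrK.
have -> : p = g - q + sumX R n * q by rewrite eg subrK.
apply: inW_step => //; first by apply: eqW; lia.
by rewrite eg; apply: nonneg_low pH q_hom p_top.
Qed.
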